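(* Let $\mathfrak A$ be a tree-automatic $\tau$-structure and let $\phi(x,y_1,\dots,y_n)$ be an $\mathsf{FO}(\exists^\infty)$-formula over $\tau$. Then there exists a finite set $\mathcal S^{\mathfrak A}_\phi$ of tree-automatic $\tau$-structures such that for every $\bar s\in A^n$ the induced substructure $\mathfrak A\restriction \phi^{\mathfrak A}(\cdot,\bar s)$ is a sum augmentation of finitely many structures, each of which is a tame box augmentation of elements of $\mathcal S^{\mathfrak A}_\phi$.
   Context: A signature $\tau$ is a finite set of relation symbols $R$ with arities $\mathrm{ar}(R)\ge 1$; a $\tau$-structure $\mathfrak A$ has universe $A$ and relations $R^{\mathfrak A}\subseteq A^{\mathrm{ar}(R)}$. For $B\subseteq A$, $\mathfrak A\restriction B$ is the induced substructure. $\mathsf{FO}(\exists^\infty)$ is first-order logic extended by the quantifier ''there exist infinitely many''. For a formula $\phi(x,y_1,\dots,y_n)$ and $\bar s\in A^n$, $\phi^{\mathfrak A}(\cdot,\bar s)=\{a\in A:\mathfrak A\models\phi(a,\bar s)\}$. Trees and automata: $\Sigma$ is a finite alphabet. A tree domain is a finite prefix-closed $D\subseteq\{0,1\}^*$; a $\Sigma$-tree is a map $t:D\to\Sigma$ with $D=\mathrm{dom}(t)$ a tree domain (the empty tree has empty domain). A (deterministic bottom-up) tree automaton $(Q,\iota,\delta,F)$ has finite state set $Q$, start state $\iota$, transition function $\delta:\Sigma\times Q\times Q\to Q$ and accepting set $F$; the state at a node $u\in\mathrm{dom}(t)$ is $\delta(t(u),q_{u0},q_{u1})$ where $q_v$ is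 the state at $v$, and the state at any $v\notin\mathrm{dom}(t)$ (a missing child, or the root of the empty tree) is $\iota$. The automaton accepts $t$ iff the state at the root $\varepsilon$ lies in $F$; a tree language is regular if recognised by such an automaton. With a fresh symbol $\Box$, the convolution $\otimes(t_1,\dots,t_n)$ is the $(\Sigma\cup\{\Box\})^n$-tree with domain $\bigcup_i\mathrm{dom}(t_i)$ whose label at $u$ is $(t_1'(u),\dots,t_n'(u))$, where $t_i'(u)=t_i(u)$ if $u\in\mathrm{dom}(t_i)$ and $\Box$ otherwise. A relation $R$ on $\Sigma$-trees is automatic if $\{\otimes\bar t:\bar t\in R\}$ is regular. A tree-automatic presentation of a $\tau$-structure $\mathfrak A$ consists of tree automata $\mathcal A$ and $(\mathcal A_R)_{R\in\tau}$ together with a bijection $\mu:A\to L(\mathcal A)$ such that $\mathcal A_R$ recognises $\{\otimes\mu(\bar a):\bar a\in R^{\mathfrak A}\}$ for every $R$; $\mathfrak A$ is tree-automatic if it has one. Augmentations: $\mathfrak A$ is a sum augmentation of $\tau$-structures $\mathfrak B_1,\dots,\mathfrak B_n$ if $A=A_1\uplus\dots\uplus A_n$ with $\mathfrak A\restriction A_i\cong\mathfrak B_i$ for all $i$. $\mathfrak A$ is a box augmentation of $\mathfrak B_1,\dots,\mathfrak B_n$ if there is a bijection $f:B_1\times\dots\times B_n\to A$ such that for every $j$ and every fixed choice of $x_i\in B_i$ ($i\ne j$) the map $b\mapsto f(x_1,\dots,x_{j-1},b,x_{j+1},\dots,x_n)$ is an embedding of $\mathfrak B_j$ into $\mathfrak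 A$ (injective, preserving and reflecting all relations). For a relation symbol $R$ of arity $r$, an $R$-colouring of a $\tau$-structure $\mathfrak B$ is a map $c:B^r\to Q$ into a finite set $Q$ such that for all $\bar t\in B^r$: $c(\bar t)\in c(R^{\mathfrak B})$ iff $\bar t\in R^{\mathfrak B}$. A box augmentation (via $f$) is tame if for every $R\in\tau$ (arity $r$) there are $R$-colourings $c_i:B_i^r\to Q_i$ of $\mathfrak B_i$ ($1\le i\le n$) such that the map $(f(\bar x_1),\dots,f(\bar x_r))\mapsto (c_i(x_{1,i},\dots,x_{r,i}))_{1\le i\le n}$ (where $\bar x_k=(x_{k,1},\dots,x_{k,n})$) is an $R$-colouring of $\mathfrak A$. *)

(* Defs.v *)
From Stdlib Require Import List.
From mathcomp Require Import all_boot.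
Set Implicit Arguments. Unset Strict Implicit. Unset Printing Implicit Defensive.

Record signature := Signature {
  sym : finType;
  ar : sym -> nat;
  ar_pos : forall R, 0 < ar R }.

Record structure (tau : signature) := Structure {
  carrier : Type;
  rel : forall R : sym tau, (ar R).-tuple carrier -> Prop }.
Arguments rel {tau} _ _ _.

Definition induced tau (A : structure tau) (B : carrier A -> Prop) : structure tau :=
  @Structure tau {x : carrier A | B x}
    (fun R t => rel A R (map_tuple (@proj1_sig _ _) t)).
Arguments induced {tau} A B.

Definition embedding tau (B A : structure tau) (f : carrier B -> carrier A) : Prop :=
  injective f /\ forall R (t : (ar R).-tuple (carrier B)), rel B R t <-> rel A R (map_tuple f t).
Arguments embedding {tau} B A f.

Definition bijective_map (X Y : Type) (f : X -> Y) : Prop :=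
  injective f /\ forall y, exists x, f x = y.

Definition isomorphic tau (A B : structure tau) : Prop :=
  exists f : carrier A -> carrier B, bijective_map f /\ embedding A B f.

Inductive formula (tau : signature) :=
  | FRel (R : sym tau) of (ar R).-tuple nat
  | FEq of nat & nat
  | FNeg of formula tau
  | FAnd of formula tau & formula tau
  | FEx of nat & formula tau
  | FExInf of nat & formula tau.

Definition infinite_set (X : Type) (P : X -> Prop) : Prop :=
  ~ exists l : list X, forall x, P x -> List.In x l.

Definition upd (X : Type) (e : nat -> X) (x : nat) (a : X) : nat -> X :=
  fun y => if y == x then a else e y.

Fixpoint sat tau (A : structure tau) (e : nat -> carrier A) (phi : formula tau) : Prop :=
  match phi with
  | FRel R v => rel A R (map_tuple e v)
  | FEq x y => e x = e y
  | FNeg psi => ~ sat e psi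
  | FAnd psi chi => sat e psi /\ sat e chi
  | FEx x psi => exists a, sat (upd e x a) psi
  | FExInf x psi => infinite_set (fun a => sat (upd e x a) psi)
  end.

Fixpoint fv_ok tau (P : nat -> Prop) (phi : formula tau) : Prop :=
  match phi with
  | FRel R v => forall i, P (tnth v i)
  | FEq x y => P x /\ P y
  | FNeg psi => fv_ok P psi
  | FAnd psi chi => fv_ok P psi /\ fv_ok P chi
  | FEx x psi => fv_ok (fun y => y = x \/ P y) psi
  | FExInf x psi => fv_ok (fun y => y = x \/ P y) psi
  end.

(* phi^A(., s) for phi(x, y_1..y_n): variable 0 is x, variable i (1<=i<=n) is y_i *)
Definition defset tau (A : structure tau) (n : nat) (phi : formula tau)
  (s : n.-tuple (carrier A)) : carrier A -> Prop :=
  fun a => sat (A:=A) (fun i => nth a (a :: s) i) phi.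

(* finite binary trees; Leaf is the empty tree (empty domain) *)
Inductive tree (S : Type) := Leaf | Node of S & tree S & tree S.
Arguments Leaf {S}.

Record automaton (S : Type) := Automaton {
  states : finType;
  iota : states;
  delta : S -> states -> states -> states;
  accepting : pred states }.
Arguments iota {S} a : rename.
Arguments delta {S} a _ _ _ : rename.
Arguments accepting {S} a _ : rename.

Fixpoint run S (M : automaton S) (t : tree S) : states M :=
  match t with
  | Leaf => iota M
  | Node a l r => delta M a (run M l) (run M r)
  end.

Definition accepts S (M : automaton S) (t : tree S) : Prop := accepting M (run M t).

Fixpoint height S (t : tree S) : nat :=
  match t with Leaf => 0 | Node _ l r => (maxn (height l) (height r)).+1 end.
Definition root_label S (t : tree S) : option S :=
  match t with Leaf => None | Node a _ _ => Some a end.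
Definition lchild S (t : tree S) : tree S :=
  match t with Leaf => Leaf | Node _ l _ => l end.
Definition rchild S (t : tree S) : tree S :=
  match t with Leaf => Leaf | Node _ _ r => r end.
Definition is_leaf S (t : tree S) : bool :=
  match t with Leaf => true | _ => false end.

(* convolution; None plays the role of the padding symbol Box *)
Fixpoint conv_aux S n (k : nat) (ts : n.-tuple (tree S)) : tree (n.-tuple (option S)) :=
  match k with
  | 0 => Leaf
  | k'.+1 =>
    if all (@is_leaf S) ts then Leaf
    else Node (map_tuple (@root_label S) ts)
              (conv_aux k' (map_tuple (@lchild S) ts))
              (conv_aux k' (map_tuple (@rchild S) ts))
  end.

Definition conv S n (ts : n.-tuple (tree S)) : tree (n.-tuple (option S)) :=
  conv_aux (\max_(t <- ts) height t) ts.

Definition tree_automatic tau (A : structure tau) : Prop :=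
  exists (Sigma : finType) (D : automaton Sigma)
         (DR : forall R : sym tau, automaton ((ar R).-tuple (option Sigma)))
         (mu : carrier A -> tree Sigma),
    injective mu /\ (forall a, accepts D (mu a)) /\
    (forall t, accepts D t -> exists a, mu a = t) /\
    (forall R t, accepts (DR R) t <->
        exists a : (ar R).-tuple (carrier A), rel A R a /\ t = conv (map_tuple mu a)).

Definition sum_augmentation tau (A : structure tau) (m : nat)
  (B : 'I_m -> structure tau) : Prop :=
  exists part : carrier A -> 'I_m,
    forall i, isomorphic (induced A (fun x => part x = i)) (B i).

Definition box_map tau (A : structure tau) (k : nat) (B : 'I_k -> structure tau)
  (f : (forall i, carrier (B i)) -> carrier A) : Prop :=
  bijective_map f /\
  forall (j : 'I_k) (x : forall i, carrier (B i)),
    embedding (B j) A (fun b : carrier (B j) => f (dfwith x b)).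
Arguments box_map {tau} A {k} B f.

(* R-colouring of a structure; the finiteness of the colour set is imposed where used *)
Definition colouring tau (A : structure tau) (R : sym tau) (Q : Type)
  (c : (ar R).-tuple (carrier A) -> Q) : Prop :=
  forall t, (exists t', rel A R t' /\ c t' = c t) <-> rel A R t.
Arguments colouring {tau} A R {Q} c.

Definition tame_box_augmentation tau (A : structure tau) (k : nat)
  (B : 'I_k -> structure tau) : Prop :=
  exists f : (forall i, carrier (B i)) -> carrier A,
    box_map A B f /\
    forall R : sym tau,
      exists (Q : 'I_k -> finType)
             (c : forall i, (ar R).-tuple (carrier (B i)) -> Q i)
             (C : (ar R).-tuple (carrier A) -> forall i, Q i),
        (forall i, colouring (B i) R (c i)) /\
        (forall (xs : (ar R).-tuple (forall i, carrier (B i))) i,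
            C (map_tuple f xs) i = c i (map_tuple (fun x => x i) xs)) /\
        colouring A R C.

(* Main.v *)
Require Import Defs.
From Stdlib Require List.
From mathcomp Require Import all_boot.
From mathcomp Require Import boolp.
Set Implicit Arguments. Unset Strict Implicit. Unset Printing Implicit Defensive.

(** A formula of FO(exists-infinitely-many) defines a set of tuples of trees that
    is saturated by a congruence of finite index.  Fix the parameters [s] and cut
    every tree [t] at a depth [k] that exceeds the heights of the parameters; below
    the cut all parameters are empty.  Record at each cut position the class of the
    subtree, namely its state for the formula against empty parameters and, for each
    [R], its state on the diagonal [(t, ..., t)].  Trees with the same part above the
    cut and the same classes all satisfy the formula or all violate it, which gives
    the finite sum; such a set of trees is a product over the cut positions.  The
    state of the automaton of [R] on a tuple of such trees is determined by its states
    at the cut positions, which gives the tame colouring.  If only one coordinate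
    varies, the other positions show diagonal states, which are fixed by the classes;
    hence membership in [R] is decided by whether the state at the varying position
    lies in a set of states, and there are only finitely many pairs of a class and
    such sets. *)

(** * Finite predicates and partitions into finitely many classes *)

(** [infinite_set] unfolds to the negation of this, so facts about infinity follow by contraposition
    from the closure lemmas below. *)
Definition finite_pred (X : Type) (P : X -> Prop) : Prop :=
  exists l : seq X, forall x, P x -> List.In x l.

Lemma finite_pred_sub X (P Q : X -> Prop) :
  (forall x, P x -> Q x) -> finite_pred Q -> finite_pred P.
Proof. by move=> PQ [l lP]; exists l => x /PQ/lP. Qed.

Lemma finite_pred_image X Y (f : X -> Y) (P : X -> Prop) :
  finite_pred P -> finite_pred (fun y => exists2 x, P x & f x = y).
Proof.
by move=> [l lP]; exists (map f l) => y [x /lP xl <-]; apply: List.in_map.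
Qed.

Lemma finite_pred_preimage X Y (f : X -> Y) (Q : Y -> Prop) :
  injective f -> finite_pred Q -> finite_pred (fun x => Q (f x)).
Proof.
move=> f_inj [l lP].
suff [l' l'P] : exists l', forall x, List.In (f x) l -> List.In x l'.
  by exists l' => x /lP/l'P.
elim: l {lP} => [|y l [l' IH]]; first by exists [::].
have [[x0 <-]|nx] := pselect (exists x, f x = y).
  by exists (x0 :: l') => x /= [/f_inj ->|/IH]; [left|right].
by exists l' => x /= [yfx|/IH //]; case: nx; exists x.
Qed.

Lemma finite_pred1 X (a : X) : finite_pred (fun x => x = a).
Proof. by exists [:: a] => x ->; left. Qed.

Lemma finite_predU X (P Q : X -> Prop) :
  finite_pred P -> finite_pred Q -> finite_pred (fun x => P x \/ Q x).
Proof.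
move=> [l lP] [l' lQ]; exists (l ++ l') => x PQx.
by apply: List.in_or_app; case: PQx => [/lP|/lQ]; [left|right].
Qed.

Lemma finite_pred_bigU X (I : finType) (P : I -> X -> Prop) :
  (forall i, finite_pred (P i)) -> finite_pred (fun x => exists i, P i x).
Proof.
move=> finP.
suff: finite_pred (fun x => exists2 i, i \in enum I & P i x).
  by apply: finite_pred_sub => x [i Pix]; exists i => //; rewrite mem_enum.
elim: (enum I) => [|i s IH]; first by exists [::] => x [].
apply: finite_pred_sub (finite_predU (finP i) IH) => x [j].
by rewrite inE => /orP[/eqP->|js] Pj; [left|right; exists j].
Qed.

Lemma finite_pred_prod X Y Z (f : X -> Y -> Z) (P : X -> Prop) (Q : Y -> Prop) :
  finite_pred P -> finite_pred Q ->
  finite_pred (fun z => exists x y, [/\ P x, Q y & z = f x y]).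
Proof.
move=> [l lP] [l' lQ]; exists (map (fun u => f u.1 u.2) (List.list_prod l l')).
move=> z [x [y [/lP xl /lQ yl ->]]].
by apply: (List.in_map (fun u => f u.1 u.2) _ (x, y)); apply: List.in_prod.
Qed.

Lemma In_mem (T : eqType) (x : T) (s : seq T) : List.In x s <-> x \in s.
Proof.
elim: s => //= y s IH; rewrite inE; split.
  by case=> [->|/IH ->]; rewrite ?eqxx ?orbT.
by case/orP => [/eqP->|/IH]; [left|right].
Qed.

(** A class is numbered by the position of its value in a duplicate-free list. Keeping only attained
    values makes every number hit, so that each class has a representative. *)
Lemma finite_image_partition X Y (g : X -> Y) :
  finite_pred (fun y => exists x, g x = y) ->
  exists m (part : X -> 'I_m),
    (forall x x', part x = part x' <-> g x = g x') /\
    forall j, exists x, part x = j.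
Proof.
case=> l0 l0P; pose l : seq {classic Y} :=
  [seq y <- undup (l0 : seq {classic Y}) | `[< exists x, g x = y >]].
have lP x : (g x : {classic Y}) \in l.
  rewrite mem_filter mem_undup; apply/andP; split; first by apply/asboolP; exists x.
  by apply/In_mem; apply: l0P; exists x.
have l_uniq : uniq l by rewrite filter_uniq ?undup_uniq.
have ix x : index (g x : {classic Y}) l < size l by rewrite index_mem.
exists (size l), (fun x => Ordinal (ix x)); split=> [x x'|j].
  split=> [[ixx']|gxx']; last by apply: val_inj; rewrite /= gxx'.
  by rewrite -[g x](nth_index (g x : {classic Y}) (lP x)) ixx' nth_index.
(* [nth] needs a default; the list is nonempty because [j] is below its size. *)
have [y0 _] : exists y : {classic Y}, true.
  by case: (l) j => [[]//|y s _]; exists y.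
have : nth y0 l j \in l by rewrite mem_nth.
rewrite {2}/l mem_filter => /andP[/asboolP[x gx] _].
by exists x; apply: val_inj; rewrite /= gx index_uniq.
Qed.

(** * Convolution and its inverse *)

Lemma tree_lr S (t : tree S) :
  t = if root_label t is Some a then Node a (lchild t) (rchild t) else Leaf.
Proof. by case: t. Qed.

Lemma is_leafP S (t : tree S) : is_leaf t -> t = Leaf.
Proof. by case: t. Qed.

Lemma root_label_None S (t : tree S) : (root_label t = None) <-> is_leaf t.
Proof. by case: t. Qed.

Section Convolution.
Variables (S : Type) (r : nat).
Implicit Type ts : r.-tuple (tree S).

Lemma height_bound (s : seq (tree S)) k :
  all (fun t => height t <= k) s = (\max_(t <- s) height t <= k).
Proof. by elim: s => [|t s IH]; rewrite ?big_nil //= big_cons geq_max IH. Qed.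

Lemma height_lchild (s : seq (tree S)) k :
  all (fun t => height t <= k.+1) s -> all (fun t => height t <= k) (map (@lchild S) s).
Proof.
rewrite all_map; apply: sub_all => -[|a l r'] //=.
by rewrite ltnS geq_max => /andP[].
Qed.

Lemma height_rchild (s : seq (tree S)) k :
  all (fun t => height t <= k.+1) s -> all (fun t => height t <= k) (map (@rchild S) s).
Proof.
rewrite all_map; apply: sub_all => -[|a l r'] //=.
by rewrite ltnS geq_max => /andP[].
Qed.

Lemma height0_leaf (s : seq (tree S)) :
  all (fun t => height t <= 0) s -> all (@is_leaf S) s.
Proof. by apply: sub_all => -[]. Qed.

Lemma conv_aux_fuel k k' ts :
  all (fun t => height t <= k) ts -> all (fun t => height t <= k') ts ->
  conv_aux k ts = conv_aux k' ts.
Proof.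
elim: k k' ts => [|k IH] [|k'] ts //=.
- by move=> /height0_leaf ->.
- by move=> _ /height0_leaf ->.
move=> hk hk'; case: ifP => // _; congr Node; apply: IH;
  by [apply: height_lchild|apply: height_rchild].
Qed.

Lemma conv_aux_conv k ts :
  all (fun t => height t <= k) ts -> conv_aux k ts = conv ts.
Proof. by move=> h; apply: conv_aux_fuel => //; rewrite height_bound. Qed.

(** One extra unit of fuel lets [conv_aux] unfold once; any fuel that bounds the heights gives the
    same result. *)
Lemma convE ts :
  conv ts = if all (@is_leaf S) ts then Leaf
            else Node (map_tuple (@root_label S) ts)
                      (conv (map_tuple (@lchild S) ts))
                      (conv (map_tuple (@rchild S) ts)).
Proof.
set k := \max_(t <- ts) height t.
have h : all (fun t => height t <= k) ts by rewrite height_bound.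
have h1 : all (fun t => height t <= k.+1) ts.
  by apply: sub_all h => t; apply: leqW.
rewrite -(conv_aux_conv h1) /=; case: ifP => // _.
by rewrite !conv_aux_conv //; [apply: height_rchild|apply: height_lchild].
Qed.

(** Stopping at the first padding symbol yields a tree even when the input is not a convolution; on
    convolutions this reads off component [i]. *)
Fixpoint proj_tree (i : 'I_r) (u : tree (r.-tuple (option S))) : tree S :=
  match u with
  | Leaf => Leaf
  | Node a l r' =>
    if tnth a i is Some b then Node b (proj_tree i l) (proj_tree i r') else Leaf
  end.

Lemma all_leaf_tnth ts i : all (@is_leaf S) ts -> tnth ts i = Leaf.
Proof. by move/all_tnthP/(_ i)/is_leafP. Qed.

Lemma proj_conv i ts : proj_tree i (conv ts) = tnth ts i.
Proof.
have [k] : exists k, all (fun t => height t <= k) ts.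
  by exists (\max_(t <- ts) height t); rewrite height_bound.
elim: k ts => [|k IH] ts h; rewrite convE.
  by rewrite (height0_leaf h) (all_leaf_tnth i (height0_leaf h)).
case: ifP => [/all_leaf_tnth -> //|_] /=.
rewrite tnth_map [in RHS](tree_lr (tnth ts i)).
rewrite IH ?IH ?tnth_map //; by [apply: height_lchild|apply: height_rchild].
Qed.

Lemma conv_inj : injective (@conv S r).
Proof. by move=> ts ts' E; apply: eq_from_tnth => i; rewrite -!proj_conv E. Qed.

Definition unconv (u : tree (r.-tuple (option S))) : r.-tuple (tree S) :=
  [tuple proj_tree i u | i < r].

Definition is_conv u : Prop := conv (unconv u) = u.

Lemma is_conv_conv ts : is_conv (conv ts).
Proof.
by congr conv; apply: eq_from_tnth => i; rewrite tnth_mktuple proj_conv.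
Qed.

(** About the children it matters only whether they are convolutions and which of their components
    are empty, so finite memory detects convolutions. *)
Lemma is_conv_Node a l r' :
  is_conv (Node a l r') <->
  [/\ is_conv l, is_conv r', exists i, tnth a i <> None
    & forall i, tnth a i = None -> is_leaf (proj_tree i l) /\ is_leaf (proj_tree i r')].
Proof.
split.
  rewrite {1}/is_conv convE; case: ifPn => //.
  move: (unconv _) => ts nl [<- <- <-]; split; try exact: is_conv_conv.
    apply: contrapT => /forallNP na; case/negP: nl; apply/all_tnthP => i.
    by apply/root_label_None; have /contrapT := na i; rewrite tnth_map.
  by move=> i; rewrite !proj_conv !tnth_map; case: (tnth ts i).
move=> [cl cr [i0 ai0] aN]; rewrite /is_conv convE; case: ifPn => [/all_leaf_tnth|_].
  by move=> /(_ i0); rewrite tnth_mktuple /=; case: (tnth a i0) ai0.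
congr Node; [|rewrite -[RHS]cl|rewrite -[RHS]cr]; last 2 first.
- congr conv; apply: eq_from_tnth => i; rewrite tnth_map !tnth_mktuple /=.
  by case E: (tnth a i) => [b|] //=; have [/is_leafP -> _] := aN i E.
- congr conv; apply: eq_from_tnth => i; rewrite tnth_map !tnth_mktuple /=.
  by case E: (tnth a i) => [b|] //=; have [_ /is_leafP ->] := aN i E.
by apply: eq_from_tnth => i; rewrite tnth_map tnth_mktuple /=; case: (tnth a i).
Qed.

End Convolution.

(** * Congruences of finite index and automata *)

Definition congruence S (Q : Type) (h : tree S -> Q) : Prop :=
  forall a l l' r r', h l = h l' -> h r = h r' -> h (Node a l r) = h (Node a l' r').

(** The values of [h] serve as states. A transition is read off from any trees realising the two
    child values, and the congruence property makes the result independent of them. *)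
Lemma congruence_automaton S (Q : finType) (h : tree S -> Q) (F : pred Q) :
  congruence h -> exists M : automaton S, forall t, accepts M t <-> F (h t).
Proof.
move=> h_cong.
have /choice[d dP] (z : S * Q * Q) : exists q, forall l r,
    h l = z.1.2 -> h r = z.2 -> h (Node z.1.1 l r) = q.
  case: z => -[a q] q' /=.
  have [[l [r [hl hr]]]|nlr] := pselect (exists l r, h l = q /\ h r = q').
    by exists (h (Node a l r)) => l' r' hl' hr'; apply: h_cong; rewrite ?hl' ?hr'.
  (* No trees realise this pair of values, so the transition is arbitrary. *)
  by exists q => l r hl hr; case: nlr; exists l, r.
pose M := @Automaton S Q (h Leaf) (fun a q q' => d (a, q, q')) F.
exists M => t; rewrite /accepts; suff -> : run M t = h t by [].
by elim: t => //= a l -> r ->; rewrite -(dP (a, h l, h r) l r).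
Qed.

(** * Recognizable sets of assignments and their closure properties *)

(** The trees of an assignment are read in parallel, an empty tree showing [None] and having empty
    children. With assignments in place of convolutions, binding a variable is a mere update. *)
Definition env_congruence S N (Q : Type) (h : (nat -> tree S) -> Q) : Prop :=
  forall e e', (forall i, i < N -> root_label (e i) = root_label (e' i)) ->
    h (@lchild S \o e) = h (@lchild S \o e') ->
    h (@rchild S \o e) = h (@rchild S \o e') -> h e = h e'.

Definition recognizable S (P : (nat -> tree S) -> Prop) : Prop :=
  exists N (Q : finType) (h : (nat -> tree S) -> Q) (F : pred Q),
    env_congruence N h /\ forall e, P e <-> F (h e).

Section Recognizable.
Variable S : finType.
Implicit Types (P : (nat -> tree S) -> Prop) (e : nat -> tree S).

Lemma recognizable_not P : recognizable P -> recognizable (fun e => ~ P e).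
Proof.
move=> [N [Q [h [F [hc hP]]]]]; exists N, Q, h, (predC F); split=> // e /=.
by rewrite hP; split=> /negP.
Qed.

Lemma recognizable_and P P' :
  recognizable P -> recognizable P' -> recognizable (fun e => P e /\ P' e).
Proof.
move=> [N [Q [h [F [hc hP]]]]] [N' [Q' [h' [F' [hc' hP']]]]].
exists (maxn N N'), (Q * Q')%type, (fun e => (h e, h' e)), (fun z => F z.1 && F' z.2).
split=> [e e' rt [l l'] [r r']|e]; last first.
  by rewrite hP hP'; split=> /andP.
by congr pair; [apply: hc|apply: hc'] => // i iN; apply: rt; rewrite leq_max iN ?orbT.
Qed.

Lemma recognizable_eq x y : recognizable (fun e => e x = e y).
Proof.
exists (maxn x y).+1, bool, (fun e => `[< e x = e y >]), id; split; last first.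
  by move=> e; split=> /asboolP.
move=> e e' rt l r; apply/asbool_equiv_eq.
have rx : root_label (e x) = root_label (e' x) by apply: rt; rewrite ltnS leq_maxl.
have ry : root_label (e y) = root_label (e' y) by apply: rt; rewrite ltnS leq_maxr.
move: (asbool_eq_equiv l) (asbool_eq_equiv r); rewrite /comp {l r} (tree_lr (e x)) (tree_lr (e y)) (tree_lr (e' x)) (tree_lr (e' y)).
rewrite rx ry; case: (root_label _) => [a|]; case: (root_label _) => [b|] //= l r.
by split=> -[-> l1 r1]; congr Node; first [by apply/l|by apply/r].
Qed.

Definition tuple_congruence r (Q : Type) (h : r.-tuple (tree S) -> Q) : Prop :=
  forall ts ts', map_tuple (@root_label S) ts = map_tuple (@root_label S) ts' ->
    h (map_tuple (@lchild S) ts) = h (map_tuple (@lchild S) ts') ->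
    h (map_tuple (@rchild S) ts) = h (map_tuple (@rchild S) ts') -> h ts = h ts'.

Lemma all_leaf_root r (ts : r.-tuple (tree S)) :
  all (@is_leaf S) ts = all (fun o => ~~ isSome o) (map_tuple (@root_label S) ts).
Proof. by rewrite all_map; apply: eq_all => -[]. Qed.

Lemma run_conv_congruence r (M : automaton (r.-tuple (option S))) :
  tuple_congruence (fun ts => run M (conv ts)).
Proof.
move=> ts ts' rt l rr; rewrite convE [in RHS]convE !all_leaf_root rt.
by case: ifP => //= _; rewrite l rr.
Qed.

Lemma recognizable_run r (M : automaton (r.-tuple (option S))) (v : r.-tuple nat) :
  recognizable (fun e => accepts M (conv (map_tuple e v))).
Proof.
exists (\max_(i <- v) i).+1, (states M), (fun e => run M (conv (map_tuple e v))).
exists (accepting M); split=> // e e' rt l rr.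
have lift (f : tree S -> tree S) e0 : map_tuple f (map_tuple e0 v) = map_tuple (f \o e0) v.
  by apply: eq_from_tnth => i; rewrite !tnth_map.
apply: run_conv_congruence; rewrite ?lift //.
apply: eq_from_tnth => i; rewrite !tnth_map; apply: rt.
exact: (@leq_bigmax_seq _ (tval v) xpredT id _ (mem_tnth i v)).
Qed.

Lemma recognizable_accepts (M : automaton S) x :
  recognizable (fun e => accepts M (e x)).
Proof.
pose h (e : nat -> tree S) := (is_leaf (e x), run M (e x)).
exists x.+1, _, h, (fun z => accepting M z.2); split=> // e e' rt.
rewrite /h /=; have := rt x (ltnSn x).
by case: (e x) => [|a l r]; case: (e' x) => [|a' l' r'] //= [->] [_ ->] [_ ->].
Qed.

Lemma comp_upd X Y (f : X -> Y) (e : nat -> X) x a : f \o upd e x a = upd (f \o e) x (f a).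
Proof. by apply/funext => y; rewrite /= /upd; case: eqP. Qed.

Lemma upd_same X (e : nat -> X) x a : upd e x a x = a.
Proof. by rewrite /upd eqxx. Qed.

Section Quantifier.
Variables (N : nat) (Q : finType) (h : (nat -> tree S) -> Q) (x : nat).
Hypothesis h_cong : env_congruence N h.

Lemma upd_congruence e e' t t' :
  (forall i, i < N -> root_label (e i) = root_label (e' i)) ->
  root_label t = root_label t' ->
  h (upd (@lchild S \o e) x (lchild t)) = h (upd (@lchild S \o e') x (lchild t')) ->
  h (upd (@rchild S \o e) x (rchild t)) = h (upd (@rchild S \o e') x (rchild t')) ->
  h (upd e x t) = h (upd e' x t').
Proof.
move=> rt rtt l r; apply: h_cong; rewrite ?comp_upd // => i iN.
by rewrite /upd; case: eqP => // _; apply: rt.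
Qed.

(* The value at the empty tree is recorded separately because a padded
   variable can only be continued by the empty tree. *)
Definition qstate e : Q * {set Q} * {set Q} :=
  (h (upd e x Leaf),
   [set q | `[< exists t, h (upd e x t) = q >]],
   [set q | `[< infinite_set (fun t => h (upd e x t) = q) >]]).

(** Attained values come from a letter and attained child values. If a value is attained infinitely
    often, so is one of the finitely many triples of letter and child values, and then one of its
    two child values is attained infinitely often. *)
Lemma qstate_congruence : env_congruence N qstate.
Proof.
(* One inclusion suffices; exchanging [e] and [e'] gives the other. *)
suff half e e' : (forall i, i < N -> root_label (e i) = root_label (e' i)) ->
    qstate (@lchild S \o e) = qstate (@lchild S \o e') ->
    qstate (@rchild S \o e) = qstate (@rchild S \o e') ->
    [/\ h (upd e x Leaf) = h (upd e' x Leaf),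
        forall q, (exists t, h (upd e x t) = q) -> exists t, h (upd e' x t) = q
      & forall q, finite_pred (fun t => h (upd e' x t) = q) ->
                  finite_pred (fun t => h (upd e x t) = q)].
  move=> e e' rt l r; have [lf ex fin] := half e e' rt l r.
  have rt' i : i < N -> root_label (e' i) = root_label (e i) by move/rt.
  have [_ ex' fin'] := half e' e rt' (esym l) (esym r).
  rewrite /qstate lf; congr (_, _, _); apply/setP => q; rewrite !inE.
    by apply/asbool_equiv_eq; split; [apply: ex|apply: ex'].
  by apply/asbool_equiv_eq; split; apply: contra_not; [apply: fin|apply: fin'].
move=> rt [ll el fl] [lr er fr].
have transf (p p' : Q -> Prop) :
    [set q | `[< p q >]] = [set q | `[< p' q >]] -> forall q, p q -> p' q.
  by move=> /setP E q pq; have := E q; rewrite !inE (asboolT pq) => /esym/asboolP.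
have lf : h (upd e x Leaf) = h (upd e' x Leaf) by apply: upd_congruence.
have step a tl tr tl' tr' :
    h (upd (@lchild S \o e) x tl) = h (upd (@lchild S \o e') x tl') ->
    h (upd (@rchild S \o e) x tr) = h (upd (@rchild S \o e') x tr') ->
    h (upd e x (Node a tl tr)) = h (upd e' x (Node a tl' tr')).
  by move=> hl hr; apply: upd_congruence.
have exl := transf _ _ el; have exr := transf _ _ er.
have finl := transf _ _ fl; have finr := transf _ _ fr.
split=> // q.
  move=> [[|a tl tr] <-]; first by exists Leaf.
  have [tl' hl] := exl _ (ex_intro _ tl erefl).
  have [tr' hr] := exr _ (ex_intro _ tr erefl).
  by exists (Node a tl' tr'); apply/esym/step.
move=> fin'.
pose T (z : S * Q * Q) t := exists tl tr, [/\ h (upd (@lchild S \o e) x tl) = z.1.2,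
  h (upd (@rchild S \o e) x tr) = z.2, t = Node z.1.1 tl tr & h (upd e x t) = q].
suff finT z : finite_pred (T z).
  apply: finite_pred_sub (finite_predU (finite_pred1 Leaf) (finite_pred_bigU finT)).
  move=> [|a tl tr] ht; [by left|right].
  exists (a, h (upd (@lchild S \o e) x tl), h (upd (@rchild S \o e) x tr)).
  by exists tl, tr.
case: z => -[a ql] qr.
have [[t0 [tl0 [tr0 [/= hl hr -> ht]]]]|nT] := pselect (exists t, T (a, ql, qr) t); last first.
  by exists [::] => t Tt; case: nT; exists t.
have [tl1 hl1] := exl _ (ex_intro _ tl0 hl).
have [tr1 hr1] := exr _ (ex_intro _ tr0 hr).
(* Over [e'], left subtrees of value [ql], completed by the fixed [tr1], inject into the finite set
   of trees of value [q]; the recorded infinitude transfers this finiteness to [e]. *)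
have fl' : finite_pred (fun t => h (upd (@lchild S \o e) x t) = ql).
  apply: contrapT => /finl; apply.
  have inj : injective (fun t => Node a t tr1) by move=> t t' [].
  apply: finite_pred_sub (finite_pred_preimage inj fin') => t /= htl.
  by rewrite -ht; apply/esym/step; rewrite ?hl ?hr ?htl ?hr1.
have fr' : finite_pred (fun t => h (upd (@rchild S \o e) x t) = qr).
  apply: contrapT => /finr; apply.
  have inj : injective (fun t => Node a tl1 t) by move=> t t' [].
  apply: finite_pred_sub (finite_pred_preimage inj fin') => t /= htr.
  by rewrite -ht; apply/esym/step; rewrite ?hl ?hr ?htr ?hl1.
apply: finite_pred_sub (finite_pred_prod (fun l r => Node a l r) fl' fr').
by move=> t [tl [tr [hl' hr' -> _]]]; exists tl, tr.
Qed.

End Quantifier.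

Lemma recognizable_ex P x :
  recognizable P -> recognizable (fun e => exists t, P (upd e x t)).
Proof.
move=> [N [Q [h [F [hc hP]]]]].
exists N, _, (qstate h x), (fun z : Q * {set Q} * {set Q} => [exists q in z.1.2, F q]).
split=> [|e]; first exact: qstate_congruence.
split=> [[t /hP Ft]|/existsP[q /andP[]]].
  by apply/existsP; exists (h (upd e x t)); rewrite Ft andbT inE; apply/asboolP; exists t.
by rewrite inE => /asboolP[t <-] Ft; exists t; apply/hP.
Qed.

(** Pigeonhole: as there are finitely many states, infinitely many witnesses mean that some
    accepting state is reached by infinitely many trees. *)
Lemma recognizable_exinf P x :
  recognizable P -> recognizable (fun e => infinite_set (fun t => P (upd e x t))).
Proof.
move=> [N [Q [h [F [hc hP]]]]].
exists N, _, (qstate h x), (fun z : Q * {set Q} * {set Q} => [exists q in z.2, F q]).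
split=> [|e]; first exact: qstate_congruence.
split=> [infP|/existsP[q /andP[]]].
  apply: contrapT => /negP/existsPn nq; apply: infP.
  have finq q : finite_pred (fun t => F q /\ h (upd e x t) = q).
    case: (boolP (F q)) => Fq; last by exists [::] => t [].
    have := nq q; rewrite Fq andbT inE => /asboolPn/contrapT.
    by apply: finite_pred_sub => t [].
  apply: finite_pred_sub (finite_pred_bigU finq) => t /hP Ft.
  by exists (h (upd e x t)).
rewrite inE => /asboolP inf Fq; apply: contra_not inf.
by apply: finite_pred_sub => t hq; apply/hP; rewrite hq.
Qed.

End Recognizable.

(** * Formulas define recognizable sets *)

Lemma infinite_set_image X Y (f : X -> Y) (P : Y -> Prop) :
  injective f ->
  infinite_set (fun x => P (f x)) <->
  infinite_set (fun y => (exists x, f x = y) /\ P y).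
Proof.
move=> f_inj; split; apply: contra_not => fin.
  apply: finite_pred_sub (finite_pred_preimage f_inj fin) => x Px.
  by split=> //; exists x.
apply: finite_pred_sub (finite_pred_image f fin) => y [[x <-] Px].
by exists x.
Qed.

(** Induction on [phi], with quantifiers relativised to the trees accepted by [D]. As [mu] is
    injective, infinitely many codes mean infinitely many elements. *)
Lemma recognizable_sat tau (A : structure tau) (S : finType) (D : automaton S)
    (DR : forall R : sym tau, automaton ((ar R).-tuple (option S)))
    (mu : carrier A -> tree S) :
  injective mu ->
  (forall t, accepts D t <-> exists a, mu a = t) ->
  (forall R (a : (ar R).-tuple (carrier A)),
     Defs.rel A R a <-> accepts (DR R) (conv (map_tuple mu a))) ->
  forall phi, exists2 P : (nat -> tree S) -> Prop, recognizable P &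
    forall e, P (mu \o e) <-> sat e phi.
Proof.
move=> mu_inj DP DRP; elim=> [R v|x y|psi [P Pr PP]|psi [P Pr PP] chi [P' Pr' PP']|
    x psi [P Pr PP]|x psi [P Pr PP]] /=.
- exists (fun e => accepts (DR R) (conv (map_tuple e v))); first exact: recognizable_run.
  move=> e; rewrite DRP; suff -> : map_tuple (mu \o e) v = map_tuple mu (map_tuple e v) by [].
  by apply: eq_from_tnth => i; rewrite !tnth_map.
- exists (fun e => e x = e y); first exact: recognizable_eq.
  by move=> e; split=> [/mu_inj|/= ->].
- exists (fun e => ~ P e); first exact: recognizable_not.
  by move=> e; rewrite PP.
- exists (fun e => P e /\ P' e); first exact: recognizable_and.
  by move=> e; rewrite PP PP'.
- exists (fun e => exists t, accepts D (upd e x t x) /\ P (upd e x t)).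
    apply: (@recognizable_ex _ (fun e => accepts D (e x) /\ P e)).
    by apply: recognizable_and => //; apply: recognizable_accepts.
  move=> e; split=> [[t []]|[a /PP]].
    by rewrite upd_same => /DP[a <-]; rewrite -comp_upd PP => ?; exists a.
  by rewrite comp_upd => ?; exists (mu a); rewrite upd_same; split=> //; apply/DP; exists a.
- exists (fun e => infinite_set (fun t => accepts D (upd e x t x) /\ P (upd e x t))).
    apply: (@recognizable_exinf _ (fun e => accepts D (e x) /\ P e)).
    by apply: recognizable_and => //; apply: recognizable_accepts.
  move=> e; under eq_fun do rewrite upd_same (propext (DP _)).
  rewrite -(infinite_set_image (fun t => P (upd (mu \o e) x t)) mu_inj).
  by under eq_fun do rewrite -comp_upd (propext (PP _)).
Qed.

Lemma sig_inj X (P : X -> Prop) (x y : {x | P x}) : proj1_sig x = proj1_sig y -> x = y.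
Proof. by case: x y => [x px] [y py] /= E; subst y; rewrite (Prop_irrelevance px py). Qed.

Lemma map_tuple_comp X Y Z r (f : Y -> Z) (g : X -> Y) (ts : r.-tuple X) :
  map_tuple f (map_tuple g ts) = map_tuple (f \o g) ts.
Proof. by apply: eq_from_tnth => i; rewrite !tnth_map. Qed.

Lemma map_tuple_const X Y r (f : X -> Y) x :
  map_tuple f [tuple x | _ < r] = [tuple f x | _ < r].
Proof. by apply: eq_from_tnth => i; rewrite tnth_map !tnth_mktuple. Qed.

Lemma map_enum_eq T (I : finType) (f g : I -> T) :
  [seq f i | i <- enum I] = [seq g i | i <- enum I] -> f =1 g.
Proof. by move=> /eq_in_map E i; apply: E; rewrite mem_enum. Qed.

(** * Tree structures with prescribed universe and accepting states *)

Section TreeStructure.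
Variables (tau : signature) (S : finType).
Variable DR : forall R : sym tau, automaton ((ar R).-tuple (option S)).

Definition conv_state R (ts : (ar R).-tuple (tree S)) : states (DR R) := run (DR R) (conv ts).

(** The transitions of [DR] are kept while universe and accepting sets vary; summands and factors
    both have this form. *)
Definition tree_structure (P : tree S -> Prop) (F : forall R, pred (states (DR R))) :
    structure tau :=
  @Structure tau {t | P t} (fun R ts => F R (conv_state (map_tuple (@proj1_sig _ _) ts))).

(** An automaton for [R] checks that the input is a convolution, that [DR R] ends in [F R], and that
    all components lie in class [z]. The product [H] tracks this together with the emptiness bits of
    [is_conv_Node]. *)
Lemma tree_structure_automatic (C : finType) (c : tree S -> C) z F :
  congruence c -> tree_automatic (tree_structure (fun t => c t = z) F).
Proof.
move=> c_cong.
have [D DP] := congruence_automaton (pred1 z) c_cong.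
pose H R (u : tree ((ar R).-tuple (option S))) :=
  (`[< is_conv u >], run (DR R) u, [tuple is_leaf (proj_tree i u) | i < ar R],
   [tuple c (proj_tree i u) | i < ar R]).
have H_cong R : congruence (@H R).
  move=> a l l' r r' [cl rl ll kl] [cr rr lr kr].
  have {}ll := map_enum_eq ll; have {}kl := map_enum_eq kl.
  have {}lr := map_enum_eq lr; have {}kr := map_enum_eq kr.
  congr (_, _, _, _).
  - apply/asbool_equiv_eq; rewrite !is_conv_Node (propext (asbool_eq_equiv cl)).
    by rewrite (propext (asbool_eq_equiv cr)); split=> -[? ? ? aN]; split=> // i /aN;
      rewrite ll lr.
  - by rewrite /= rl rr.
  - by apply: eq_from_tnth => i; rewrite !tnth_mktuple /=; case: (tnth a i).
  apply: eq_from_tnth => i; rewrite !tnth_mktuple /=; case: (tnth a i) => // b.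
  exact: c_cong.
pose G R : pred (bool * states (DR R) * (ar R).-tuple bool * (ar R).-tuple C) :=
  fun w => [&& w.1.1.1, F R w.1.1.2 & [forall i, tnth w.2 i == z]].
have /fin_all_exists[DR' DR'P] R := congruence_automaton (@G R) (@H_cong R).
exists S, D, DR', (@proj1_sig _ _); split; first exact: sig_inj.
split; first by case=> t /= tz; apply/DP/eqP.
split; first by move=> t /DP/eqP tz; exists (exist _ t tz).
move=> R u; rewrite DR'P /G /=; split.
  move=> /and3P[/asboolP cu Fu /forallP zu].
  have zi i : c (proj_tree i u) = z by have := zu i; rewrite tnth_mktuple => /eqP.
  pose a := [tuple exist (fun t => c t = z) (proj_tree i u) (zi i) | i < ar R].
  have aE : map_tuple (@proj1_sig _ _) a = unconv u.
    by apply: eq_from_tnth => i; rewrite tnth_map !tnth_mktuple.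
  by exists a; split; rewrite /= /conv_state aE cu.
move=> [a [/= Fa ->]]; apply/and3P; split=> //; first by apply/asboolP/is_conv_conv.
apply/forallP => i; rewrite tnth_mktuple proj_conv tnth_map.
by case: (tnth a i) => t /= ->.
Qed.

(** * Cutting trees at depth [k] *)

Section Decomposition.
Variables (C : finType) (c : tree S -> C).

(** A cut position shows its class even if the subtree there is empty; a tree that ends above the
    cut shows [Leaf]. *)
Fixpoint skeleton k (t : tree S) : tree (S + C) :=
  match k, t with
  | 0, _ => Node (inr (c t)) Leaf Leaf
  | _.+1, Leaf => Leaf
  | k'.+1, Node a l r => Node (inl a) (skeleton k' l) (skeleton k' r)
  end.

Lemma skeleton_finite k : finite_pred (fun y => exists t, skeleton k t = y).
Proof.
elim: k => [|k IH] /=.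
  have fin1 (q : C) := finite_pred1 (Node (inr q : S + C) Leaf Leaf).
  by apply: finite_pred_sub (finite_pred_bigU fin1) => y [t <-]; exists (c t).
have fin2 (a : S) := finite_pred_prod (fun l r => Node (inl a : S + C) l r) IH IH.
apply: finite_pred_sub (finite_predU (finite_pred1 Leaf) (finite_pred_bigU fin2)).
move=> y [[|a l r] <-]; [by left|right; exists a, (skeleton k l), (skeleton k r)].
by split=> //; [exists l|exists r].
Qed.

(** The index [i] runs over the cut positions of [t0], [p i] reads the subtree there, and [fill]
    grafts subtrees back. Above the cut all trees with this skeleton agree, so a congruence is
    computed upwards from its values at the cut. *)
Lemma skeleton_coordinates k t0 :
  exists m (p : 'I_m -> tree S -> tree S) (fill : ('I_m -> tree S) -> tree S),
    [/\ forall x, (forall i, c (x i) = c (p i t0)) ->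
          skeleton k (fill x) = skeleton k t0 /\ forall i, p i (fill x) = x i,
        forall t, skeleton k t = skeleton k t0 ->
          fill (p ^~ t) = t /\ forall i, c (p i t) = c (p i t0)
      & forall r (Q : Type) (h : r.-tuple (tree S) -> Q), tuple_congruence h ->
          forall ts ts' : r.-tuple (tree S),
          (forall i, skeleton k (tnth ts i) = skeleton k t0) ->
          (forall i, skeleton k (tnth ts' i) = skeleton k t0) ->
          (forall i, h (map_tuple (p i) ts) = h (map_tuple (p i) ts')) ->
          h ts = h ts'].
Proof.
have map_idt r (ts : r.-tuple (tree S)) : map_tuple id ts = ts.
  by apply: eq_from_tnth => i; rewrite tnth_map.
elim: k t0 => [|k IH] t0.
  exists 1, (fun _ t => t), (fun x => x ord0); split=> /=.
  - by move=> x ->; split=> // i; rewrite (ord1 i).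
  - by move=> t [->].
  by move=> r Q h _ ts ts' _ _ /(_ ord0); rewrite !map_idt.
case: t0 => [|a l0 r0].
  (* The tree ends above the cut: there are no coordinates, and [Leaf] is the only tree with this
     skeleton. *)
  exists 0, (fun _ t => t), (fun _ => Leaf); split=> /=.
  - by move=> x _; split=> // -[].
  - by case=> // _; split=> // -[].
  have leaf t : skeleton k.+1 t = Leaf -> t = Leaf by case: t.
  move=> r Q h _ ts ts' tsL tsL' _; congr h.
  by apply: eq_from_tnth => i; rewrite (leaf _ (tsL i)) (leaf _ (tsL' i)).
have [m1 [p1 [f1 [fillP1 pP1 hP1]]]] := IH l0.
have [m2 [p2 [f2 [fillP2 pP2 hP2]]]] := IH r0.
pose p (i : 'I_(m1 + m2)) t :=
  match split i with inl i1 => p1 i1 (lchild t) | inr i2 => p2 i2 (rchild t) end.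
have pl i t : p (lshift m2 i) t = p1 i (lchild t) by rewrite /p (unsplitK (inl i)).
have pr i t : p (rshift m1 i) t = p2 i (rchild t) by rewrite /p (unsplitK (inr i)).
have skelN t : skeleton k.+1 t = skeleton k.+1 (Node a l0 r0) ->
    [/\ root_label t = Some a, skeleton k (lchild t) = skeleton k l0
      & skeleton k (rchild t) = skeleton k r0].
  by case: t => //= b l r [-> -> ->].
exists (m1 + m2), p,
  (fun x => Node a (f1 (fun i => x (lshift m2 i))) (f2 (fun i => x (rshift m1 i)))).
split.
- move=> x xc /=.
  have [i|-> pf1] := fillP1 (fun i => x (lshift m2 i)); first by rewrite xc pl.
  have [i|-> pf2] := fillP2 (fun i => x (rshift m1 i)); first by rewrite xc pr.
  by split=> // i; case: (split_ordP i) => j ->; rewrite ?pl ?pr /= ?pf1 ?pf2.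
- move=> t tt0; have [rt /pP1[fl cl] /pP2[fr cr]] := skelN _ tt0.
  split; last by move=> i; case: (split_ordP i) => j ->; rewrite ?pl ?pr ?cl ?cr.
  rewrite [RHS](tree_lr t) rt; congr Node; [rewrite -[RHS]fl|rewrite -[RHS]fr].
    by congr f1; apply/funext => i; rewrite pl.
  by congr f2; apply/funext => i; rewrite pr.
move=> r Q h hc ts ts' tsP tsP' E; apply: (hc).
- apply: eq_from_tnth => i; rewrite !tnth_map.
  by have [-> _ _] := skelN _ (tsP i); have [-> _ _] := skelN _ (tsP' i).
- apply: hP1 => //.
  + by move=> i; rewrite tnth_map; have [] := skelN _ (tsP i).
  + by move=> i; rewrite tnth_map; have [] := skelN _ (tsP' i).
  by move=> i; rewrite !map_tuple_comp -[_ \o _](funext (pl i)) E.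
apply: hP2 => //.
- by move=> i; rewrite tnth_map; have [] := skelN _ (tsP i).
- by move=> i; rewrite tnth_map; have [] := skelN _ (tsP' i).
by move=> i; rewrite !map_tuple_comp -[_ \o _](funext (pr i)) E.
Qed.

Hypothesis c_diag : forall R t t', c t = c t' ->
  conv_state [tuple t | _ < ar R] = conv_state [tuple t' | _ < ar R].

(** The index ranges over a finite type that mentions neither [k] nor a skeleton, so one finite
    collection serves every cut. *)
Definition factor (z : C * {dffun forall R : sym tau, {set states (DR R)}}) :
    structure tau :=
  tree_structure (fun t => c t = z.1) (fun R q => q \in z.2 R).

Lemma skeleton_box k t0 :
  exists m (z : 'I_m -> C * {dffun forall R : sym tau, {set states (DR R)}}),
    tame_box_augmentation
      (tree_structure (fun t => skeleton k t = skeleton k t0) (fun R => accepting (DR R)))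
      (fun i => factor (z i)).
Proof.
have [m [p [fill [fillP pP stP]]]] := skeleton_coordinates k t0.
have {}stP R := stP _ _ _ (@run_conv_congruence _ _ (DR R)).
(* With the other coordinates frozen, the [R]-states outside coordinate [j] are
   the diagonal ones, which depend on the class only. *)
pose Facc j R (q : states (DR R)) := exists ts : (ar R).-tuple (tree S),
  [/\ forall i, skeleton k (tnth ts i) = skeleton k t0,
      conv_state (map_tuple (p j) ts) = q,
      forall i, j != i ->
        conv_state (map_tuple (p i) ts) = conv_state [tuple p i t0 | _ < ar R]
    & accepting (DR R) (conv_state ts)].
pose z (j : 'I_m) : C * {dffun forall R : sym tau, {set states (DR R)}} :=
  (c (p j t0), [ffun R => [set q | `[< @Facc j R q >]]]).
exists m, z.
pose X := forall i, carrier (factor (z i)).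
have fillX (x : X) := fillP (fun i => proj1_sig (x i)) (fun i => proj2_sig (x i)).
set B := tree_structure _ _.
pose f (x : X) : carrier B :=
  exist (fun t => skeleton k t = skeleton k t0) _ (proj1 (fillX x)).
have fP x i : p i (proj1_sig (f x)) = proj1_sig (x i) := proj2 (fillX x) i.
exists f; split; [split; [split|]|].
- move=> x x' fxx'; apply: functional_extensionality_dep => i; apply: sig_inj.
  by rewrite -!fP fxx'.
- move=> [t tP]; have [ft cp] := pP t tP.
  exists (fun i => exist (fun t' => c t' = (z i).1) (p i t) (cp i)).
  exact: sig_inj.
- move=> j x; split.
    move=> b b' fbb'; apply: sig_inj.
    by rewrite -[b](dfwith_in x) -fP fbb' fP dfwith_in.
  move=> R t; rewrite /= ffunE inE.
  set ts' := map_tuple _ (map_tuple _ t).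
  have ts'S i : skeleton k (tnth ts' i) = skeleton k t0.
    by rewrite !tnth_map; exact: (proj2_sig (f _)).
  have ts'j : map_tuple (p j) ts' = map_tuple (@proj1_sig _ _) t.
    by apply: eq_from_tnth => i; rewrite !tnth_map fP dfwith_in.
  have ts'i i : j != i ->
      conv_state (map_tuple (p i) ts') = conv_state [tuple p i t0 | _ < ar R].
    move=> ji; rewrite -(@c_diag R _ _ (proj2_sig (x i))); congr conv_state.
    by apply: eq_from_tnth => l; rewrite !tnth_map fP dfwith_out.
  split=> [/asboolP[ts [tsS tsj tsi acc]]|acc]; last first.
    by apply/asboolP; exists ts'; split=> //; rewrite ts'j.
  (* The witness [ts] and the given [ts'] have equal states at [j], and diagonal states elsewhere;
     hence their full states agree. *)
  suff <- : conv_state ts = conv_state ts' by [].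
  apply: stP => // i; have [<-|ji] := eqVneq j i; first by rewrite ts'j.
  by rewrite -!/(conv_state _) tsi // ts'i.
(* Colours are states of [DR R]. The states at all cut positions determine the full state, hence
   membership in the relation. *)
move=> R; exists (fun _ => states (DR R)),
  (fun i t => conv_state (map_tuple (@proj1_sig _ _) t)),
  (fun t i => conv_state (map_tuple (p i) (map_tuple (@proj1_sig _ _) t))).
split; [|split].
- by move=> i t; split=> [[t' [/= Ft' <-]]|Ft] //; exists t.
- move=> xs i; congr conv_state.
  by apply: eq_from_tnth => l; rewrite !tnth_map fP.
move=> t; split=> [[t' [acc E]]|Ft]; last by exists t.
rewrite /=; suff <- : conv_state (map_tuple (@proj1_sig _ _) t') =
  conv_state (map_tuple (@proj1_sig _ _) t) by [].
have tS (u : (ar R).-tuple (carrier B)) i :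
    skeleton k (tnth (map_tuple (@proj1_sig _ _) u) i) = skeleton k t0.
  by rewrite tnth_map; case: (tnth u i).
apply: stP => // i.
exact: (congr1 (fun g : 'I_m -> states (DR R) => g i) E).
Qed.

End Decomposition.
End TreeStructure.

(** * Parameters and the cut *)

(** This mirrors the assignment in [defset]: [t] is variable 0 and also the default beyond the
    parameters. *)
Definition param_env S (s : seq (tree S)) (t : tree S) : nat -> tree S := nth t (t :: s).

Lemma comp_nth X Y (f : X -> Y) (x0 : X) (s : seq X) :
  f \o nth x0 s = nth (f x0) (map f s).
Proof. by apply/funext; elim: s => [|x s IH] [|i] //=; apply: IH. Qed.

Lemma comp_param_env S (f : tree S -> tree S) s t :
  f \o param_env s t = param_env (map f s) (f t).
Proof. exact: comp_nth. Qed.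

Lemma map_nseq_leaf S n (f : tree S -> tree S) :
  f Leaf = Leaf -> map f (nseq n Leaf) = nseq n Leaf.
Proof. by move=> fL; rewrite map_nseq fL. Qed.

(** At depth [k] all parameters have become empty, and there the class fixes [h]; above, [t] and
    [t'] carry the same labels, so equality propagates to the root. *)
Lemma param_env_skeleton (S : finType) (C : finType) (c : tree S -> C) (Q : Type) N
    (h : (nat -> tree S) -> Q) n k s t t' :
  env_congruence N h ->
  (forall t t', c t = c t' ->
     h (param_env (nseq n Leaf) t) = h (param_env (nseq n Leaf) t')) ->
  size s = n -> all (fun u => height u <= k) s ->
  skeleton c k t = skeleton c k t' -> h (param_env s t) = h (param_env s t').
Proof.
move=> hc cP; elim: k s t t' => [|k IH] s t t' ss hs.
  have -> : s = nseq n Leaf.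
    rewrite -ss; elim: (s) (height0_leaf hs) => //= u s' IH /andP[/is_leafP -> /IH E].
    by rewrite -E.
  by move=> [/cP].
move=> E.
have [rt l r] : [/\ root_label t = root_label t',
    skeleton c k (lchild t) = skeleton c k (lchild t')
  & skeleton c k (rchild t) = skeleton c k (rchild t')].
  by case: t t' E => [|a tl tr] [|b tl' tr'] //= [-> -> ->].
apply: hc; rewrite ?comp_param_env; last 2 first.
- by apply: IH l; rewrite ?size_map //; apply: height_lchild.
- by apply: IH r; rewrite ?size_map //; apply: height_rchild.
move=> i _.
rewrite -[LHS]/((@root_label S \o param_env s t) i) -[RHS]/((@root_label S \o param_env s t') i).
by rewrite /param_env !comp_nth /= rt.
Qed.

(** * Partition of the defined set by skeletons *)

Theorem theorem3p8 (tau : signature) (A : structure tau) (hA : tree_automatic A)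
  (n : nat) (phi : formula tau) (hphi : fv_ok (fun i => i <= n) phi) :
  exists (N : nat) (S : 'I_N -> structure tau),
    (forall i, tree_automatic (S i)) /\
    forall s : n.-tuple (carrier A),
      exists (m : nat) (B : 'I_m -> structure tau),
        sum_augmentation (induced A (defset phi s)) B /\
        forall j : 'I_m,
          exists (k : nat) (g : 'I_k -> 'I_N),
            tame_box_augmentation (B j) (fun i => S (g i)).
Proof.
case: hA => Sg [D [DR [mu [mu_inj [muD [Dmu DRP]]]]]].
have DP t : accepts D t <-> exists a, mu a = t.
  by split=> [/Dmu//|[a <-]]; apply: muD.
have relP R (a : (ar R).-tuple (carrier A)) :
    Defs.rel A R a <-> accepts (DR R) (conv (map_tuple mu a)).
  rewrite DRP; split=> [ra|[a' [ra' /conv_inj E]]]; first by exists a.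
  suff -> : a = a' by [].
  apply: eq_from_tnth => i; apply: mu_inj.
  by rewrite -[LHS]tnth_map -[RHS]tnth_map; congr tnth; exact: E.
have [P0 P0r P0P] := recognizable_sat mu_inj DP relP phi.
(* Adding acceptance by [D] at variable 0 ensures that every tree passing [F] is the code of an
   element. *)
have [N [Q [h [F [hc hP]]]]] := recognizable_and (recognizable_accepts D 0) P0r.
pose c t : Q * {dffun forall R : sym tau, states (DR R)} :=
  (h (param_env (nseq n Leaf) t), [ffun R => conv_state DR [tuple t | _ < ar R]]).
have c_diag R t t' : c t = c t' ->
    conv_state DR [tuple t | _ < ar R] = conv_state DR [tuple t' | _ < ar R].
  by case=> _ /ffunP/(_ R); rewrite !ffunE.
have c_h t t' : c t = c t' ->
    h (param_env (nseq n Leaf) t) = h (param_env (nseq n Leaf) t') by case.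
(* Children of empty parameters are empty, and children of a diagonal tuple are diagonal. *)
have c_cong : congruence c.
  move=> a l l' r r' el er; congr pair.
    apply: hc; rewrite ?comp_param_env ?map_nseq_leaf //; [|exact: c_h|exact: c_h].
    move=> i _.
    rewrite -[LHS]/((@root_label Sg \o param_env _ _) i).
    rewrite -[RHS]/((@root_label Sg \o param_env _ _) i).
    by rewrite /param_env !comp_nth.
  apply/ffunP => R; rewrite !ffunE; apply: run_conv_congruence; rewrite !map_tuple_const //.
    exact: c_diag.
  exact: c_diag.
pose I : finType := ((Q * {dffun forall R : sym tau, states (DR R)}) *
  {dffun forall R : sym tau, {set states (DR R)}})%type.
exists #|I|, (fun i => factor c (enum_val i : I)); split.
  by move=> i; apply: tree_structure_automatic.
(* A single node has height 1, so a tree of height at most [k] has no node at depth [k]. *)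
move=> s; pose k := \max_(u <- map mu s) height u.
have mu_env a : mu \o (fun i => nth a (a :: s) i) = param_env (map mu s) (mu a).
  exact: comp_nth.
have defP a : defset phi s a <-> F (h (param_env (map mu s) (mu a))).
  rewrite -hP -mu_env P0P; split=> [sa|[_ sa]//]; split=> //; exact: muD.
have [|m [part [partP part_onto]]] :=
    @finite_image_partition {a | defset phi s a} _ (fun a => skeleton c k (mu (proj1_sig a))).
  by apply: finite_pred_sub (skeleton_finite c k) => y [a <-]; exists (mu (proj1_sig a)).
have /fin_all_exists[rep repP] := part_onto.
pose t0 j := mu (proj1_sig (rep j)).
exists m, (fun j => tree_structure (DR := DR) (fun t => skeleton c k t = skeleton c k (t0 j))
                      (fun R => accepting (DR R))).
split; last first.
  move=> j; have [l [z zP]] := skeleton_box c_diag k (t0 j).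
  exists l, (fun i => enum_rank (z i)).
  suff -> : (fun i => factor c (enum_val (enum_rank (z i)) : I)) = (fun i => factor c (z i)) by [].
  by apply/funext => i; rewrite enum_rankK.
exists part => j.
have skelP (x : {x | part x = j}) :
    skeleton c k (mu (proj1_sig (proj1_sig x))) = skeleton c k (t0 j).
  by case: x => x xj; apply/partP; rewrite repP.
pose f x := exist (fun t => skeleton c k t = skeleton c k (t0 j)) _ (skelP x).
have f_inj : injective f.
  by move=> x x' [/mu_inj E]; apply: sig_inj; apply: sig_inj.
exists f; split; split=> //.
  (* Surjectivity: [t] shares its skeleton with a representative, so it passes [F]; hence it is the
     code of an element of the defined set, which lies in part [j]. *)
  case=> t tj.
  have hs : all (fun u => height u <= k) (map mu s) by rewrite height_bound.
  have Ft : F (h (param_env (map mu s) t)).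
    rewrite (param_env_skeleton hc c_h _ hs tj) ?size_map ?size_tuple //.
    by apply/defP; case: (rep j).
  have [/DP[a ta] _] := (hP _).2 Ft; rewrite /param_env /= in ta; subst t.
  have pa : part (exist _ a ((defP a).2 Ft)) = j by rewrite -(repP j); apply/partP.
  by exists (exist (fun x => part x = j) _ pa); apply: sig_inj.
move=> R t; rewrite /= relP /accepts /conv_state !map_tuple_comp.
suff -> : map_tuple (mu \o (@proj1_sig _ _ \o @proj1_sig _ _)) t =
          map_tuple (@proj1_sig _ _ \o f) t by [].
by apply: eq_from_tnth => i; rewrite !tnth_map.
Qed.
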